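(* Let $n,m\in\mathbb{N}$ and let $f_0,f_1,\dots,f_m\in\mathrm{LC}_n$. Set $\bar f=(f_0,f_1,\dots,f_m)$. Then $$\|(\bar f)_{\oplus_m}\|_\infty\,\|(\bar f)_{\star_m}\|_1\;\leq\;\binom{n(m+1)}{n}\prod_{i=0}^m\|f_i\|_\infty\|f_i\|_1 .$$
   Context: $\mathrm{LC}_n$ is the set of functions $f:\mathbb{R}^n\to[0,\infty)$ that are log-concave ($f((1-\lambda)x+\lambda y)\ge f(x)^{1-\lambda}f(y)^\lambda$ for all $x,y$, $\lambda\in[0,1]$), upper semicontinuous, Lebesgue integrable, and not a.e. equal to zero. $\|\cdot\|_1$ is the integral and $\|\cdot\|_\infty$ the essential supremum of a nonnegative function on the Euclidean space on which it is defined. For $\bar x=(x_1,\dots,x_m)\in(\mathbb{R}^n)^m=\mathbb{R}^{nm}$, $$(\bar f)_{\oplus_m}(\bar x)=\int_{\mathbb{R}^n}f_0(z)f_1(z-x_1)\cdots f_m(z-x_m)\,dz,\qquad (\bar f)_{\star_m}(\bar x)=\sup_{z\in\mathbb{R}^n}f_0(z)f_1(z-x_1)\cdots f_m(z-x_m).$$ *)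

(* Defs.v *)
From HB Require Import structures.
From mathcomp Require Import all_boot all_order all_algebra.
From mathcomp Require Import all_classical all_reals all_analysis ess_sup_inf.

Set Implicit Arguments.
Unset Strict Implicit.
Unset Printing Implicit Defensive.

Import Order.TTheory GRing.Theory Num.Theory.
Import numFieldNormedType.Exports.

Local Open Scope classical_set_scope.
Local Open Scope ring_scope.

Definition measure_matrix_display : measure_display -> measure_display.
Proof. exact. Qed.

Section measurable_matrix.
Context {d} {T : sigmaRingType d}.
Variables m n : nat.

Definition mx_cylinder : set (set 'M[T]_(m, n)) :=
  [set A | exists i j (B : set T),
     measurable B /\ A = [set x : 'M[T]_(m, n) | B (x i j)]].

Let mx_set0 : <<s mx_cylinder >> set0.
Proof. exact: sigma_algebra0. Qed.

Let mx_setC A : <<s mx_cylinder >> A -> <<s mx_cylinder >> (~` A).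
Proof. exact: sigma_algebraC. Qed.

Let mx_bigcup (F : _^nat) : (forall i, <<s mx_cylinder >> (F i)) ->
  <<s mx_cylinder >> (\bigcup_i (F i)).
Proof. exact: sigma_algebra_bigcup. Qed.

HB.instance Definition _ := @isMeasurable.Build (measure_matrix_display d)
  'M[T]_(m, n) <<s mx_cylinder >> mx_set0 mx_setC mx_bigcup.

End measurable_matrix.

Lemma measurable_coord d (T : sigmaRingType d) m n i j :
  measurable_fun [set: 'M[T]_(m, n)] (fun x : 'M[T]_(m, n) => x i j).
Proof.
move=> _ Y mY; rewrite setTI; apply: sub_sigma_algebra => /=.
by exists i, j, Y.
Qed.

Lemma measurable_fun_mxP d1 d2 (T1 : measurableType d1) (T2 : measurableType d2)
    m n (f : T1 -> 'M[T2]_(m, n)) :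
  measurable_fun [set: T1] f <->
  forall i j, measurable_fun [set: T1] (fun t => f t i j).
Proof.
split=> [mf i j|mf].
  exact: (measurableT_comp (@measurable_coord _ T2 m n i j) mf).
apply: (@measurability _ _ _ _ _ _ (@mx_cylinder _ T2 m n)) => //.
move=> _ [_ [i [j [B [mB ->]]]] <-].
by rewrite setTI; have := mf i j measurableT B mB; rewrite setTI.
Qed.

Lemma measurable_mxE (R : realType) m n :
  @measurable _ 'M[R]_(m, n) = <<s @open 'M[R]_(m, n) >>.
Proof.
apply/seteqP; split.
  apply: smallest_sub; first exact: smallest_sigma_algebra.
  move=> _ [i [j [B [mB ->]]]].
  pose c (x : 'M[R]_(m, n)) := x i j.
  pose G := image_set_system setT c <<s @open 'M[R]_(m, n) >>.
  suff : G B by rewrite /G /image_set_system /= setTI.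
  have sG : sigma_algebra setT G.
    by apply: sigma_algebra_image; exact: smallest_sigma_algebra.
  have := mB; rewrite [measurable]measurable_realfun.RGenOpens.measurableE; apply; split=> //.
  move=> _ [x [y ->]]; rewrite /G /image_set_system /= setTI.
  apply: sub_sigma_algebra; apply: open_comp; last exact: itv_open.
  by move=> z _; exact: coord_continuous.
apply: smallest_sub.
  exact: sigma_algebra_measurable.
move=> U oU.
pose box (q : 'M[rat]_(m, n) * 'M[rat]_(m, n)) := [set x : 'M[R]_(m, n) |
  forall i j, ratr (q.1 i j) < x i j < ratr (q.2 i j)].
have mbox q : measurable (box q).
  rewrite (_ : box q = \bigcap_(k in [set: 'I_m * 'I_n])
    ((fun x : 'M[R]_(m, n) => x k.1 k.2) @^-1`
      `]ratr (q.1 k.1 k.2), ratr (q.2 k.1 k.2)[%classic)).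
    apply: fin_bigcap_measurable => // -[i j] _.
    rewrite -[X in measurable X]setTI.
    by apply: measurable_coord => //; exact: measurable_itv.
  apply/seteqP; split => [x /= xq [i j] _|x xq i j] /=.
    by rewrite in_itv/= xq.
  by have := xq (i, j) Logic.I; rewrite /= in_itv.
rewrite (_ : U = \bigcup_q (if pselect (box q `<=` U) then box q else set0)).
  apply: countable_bigcupT_measurable => [|q]; first exact: countableP.
  by case: (pselect _) => ?; [exact: mbox|exact: measurable0].
apply/seteqP; split => [x Ux|x [q _]]; last first.
  by case: (pselect _) => // qU; exact: qU.
have [P xP PU] : nbhs x U by exact: open_nbhs_nbhs.
have /choice[q qP] : forall k : 'I_m * 'I_n, exists q : rat * rat,
    ratr q.1 < x k.1 k.2 < ratr q.2 /\
    (forall y : R, ratr q.1 < y < ratr q.2 -> P k.1 k.2 y).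
  move=> [i j] /=; have /nbhs_ballP[e /= e0 eP] := xP i j.
  have [a a_lt] : exists a, ratr a \in `]x i j - e, x i j[.
    by apply: rat_in_itvoo; rewrite ltrBlDr ltrDl.
  have [b b_gt] : exists b, ratr b \in `]x i j, x i j + e[.
    by apply: rat_in_itvoo; rewrite ltrDl.
  move: a_lt b_gt; rewrite !in_itv/= => /andP[ea ax] /andP[xb be].
  exists (a, b); split; first by rewrite /= ax xb.
  move=> y /= /andP[ay yb]; apply: eP; rewrite /ball /= ltr_distlC.
  by rewrite (lt_trans ea ay) (lt_trans yb be).
exists (\matrix_(i, j) (q (i, j)).1, \matrix_(i, j) (q (i, j)).2) => //.
case: (pselect _) => [? i j|]; first by rewrite !mxE; have [] := qP (i, j).
move=> nU; exfalso; apply: nU => y yq; apply: PU => i j.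
by have [_] := qP (i, j); apply; have := yq i j; rewrite !mxE.
Qed.

Lemma pushforward_sigma_finite d1 d2 (T1 : measurableType d1)
    (T2 : measurableType d2) (R : realType) (f : T1 -> T2) (g : T2 -> T1)
    (mu : set T1 -> \bar R) :
  measurable_fun setT g -> cancel f g ->
  sigma_finite setT mu -> sigma_finite setT (pushforward mu f).
Proof.
move=> mg fK [F TF Foo].
exists (fun k => g @^-1` F k).
  by rewrite -preimage_bigcup -TF.
move=> k; have [mF Fk] := Foo k; split.
  by rewrite -[X in measurable X]setTI; exact: mg.
rewrite /pushforward -comp_preimage (_ : g \o f = idfun)//.
by apply/funext => x /=; rewrite fK.
Qed.

(* The library proves this too, but the canonical instance on _ \x _ is shadowed
   by the one for subprobabilities, so it is not inferred. *)
Lemma product_sigma_finite d1 d2 (T1 : measurableType d1)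
    (T2 : measurableType d2) (R : realType)
    (mu : {sigma_finite_measure set T1 -> \bar R})
    (nu : {sigma_finite_measure set T2 -> \bar R}) :
  sigma_finite setT (mu \x nu)%E.
Proof.
have /sigma_finiteP[F [TF ndF Foo]] := sigma_finiteT mu.
have /sigma_finiteP[G [TG ndG Goo]] := sigma_finiteT nu.
exists (fun k => F k `*` G k).
  rewrite -setXTT TF TG; apply/seteqP; split => -[x y].
    move=> [/= [k _ Fx] [l _ Gy]]; exists (maxn k l) => //; split.
      by move: x Fx; exact/subsetPset/ndF/leq_maxl.
    by move: y Gy; exact/subsetPset/ndG/leq_maxr.
  by move=> [k _ [/= Fx Gy]]; split; exists k.
move=> k; have [mF Fk] := Foo k; have [mG Gk] := Goo k; split.
  exact: measurableX.
by rewrite product_measure1E// lte_mul_pinfty// ge0_fin_numE.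
Qed.

Section tuple_cons_measure.
Local Open Scope ereal_scope.
Context d (T : measurableType d) (R : realType) (n : nat).
Variables (mu : {sigma_finite_measure set T -> \bar R})
          (nu : {sigma_finite_measure set (n.-tuple T) -> \bar R}).

Definition tuple_cons (p : T * n.-tuple T) : n.+1.-tuple T :=
  [tuple of p.1 :: p.2].

Lemma measurable_tuple_cons : measurable_fun setT tuple_cons.
Proof. exact: measurable_cons. Qed.

Definition tuple_cons_measure : set (n.+1.-tuple T) -> \bar R :=
  pushforward (mu \x nu) tuple_cons.

Let m0 : tuple_cons_measure set0 = 0.
Proof. by apply: measure0; exact: measurable_tuple_cons. Qed.

Let m_ge0 A : 0 <= tuple_cons_measure A.
Proof. by apply: measure_ge0; exact: measurable_tuple_cons. Qed.

Let m_sigma_additive : semi_sigma_additive tuple_cons_measure.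
Proof.
by apply: measure_semi_sigma_additive; exact: measurable_tuple_cons.
Qed.

HB.instance Definition _ := isMeasure.Build _ _ _ tuple_cons_measure
  m0 m_ge0 m_sigma_additive.

Let m_sigma_finite : sigma_finite setT tuple_cons_measure.
Proof.
apply: (@pushforward_sigma_finite _ _ _ _ _ tuple_cons
  (fun t : n.+1.-tuple T => (thead t, [tuple of behead t])) (mu \x nu)); last exact: product_sigma_finite.
  apply/measurable_fun_pairP; split; first exact: measurable_tnth.
  exact: measurable_behead.
by move=> [x t] /=; rewrite theadE; congr pair; apply/val_inj.
Qed.

HB.instance Definition _ := Measure_isSigmaFinite.Build _ _ _
  tuple_cons_measure m_sigma_finite.

End tuple_cons_measure.

Fixpoint tuple_measure d (T : measurableType d) (R : realType)
    (mu : {sigma_finite_measure set T -> \bar R}) (n : nat) :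
    {sigma_finite_measure set (n.-tuple T) -> \bar R} :=
  if n is k.+1 then tuple_cons_measure mu (tuple_measure mu k)
  else \d_[tuple].

(* n-dimensional Lebesgue measure is the n-fold product of the one on the line;
   lebesgue_rV_box and lebesgue_mx_box below give the volume of boxes. *)
Section lebesgue_rV.
Local Open Scope ereal_scope.
Context (R : realType) (n : nat).

Definition rV_of_tuple (t : n.-tuple (measurableTypeR R)) : 'rV[R]_n :=
  \row_j tnth t j.

Lemma measurable_rV_of_tuple : measurable_fun setT rV_of_tuple.
Proof.
apply/measurable_fun_mxP => i j.
rewrite (_ : (fun _ => _) = fun t => tnth t j).
  exact: measurable_tnth.
by apply/funext => t; rewrite mxE.
Qed.

Definition lebesgue_rV : set 'rV[R]_n -> \bar R :=
  pushforward (tuple_measure lebesgue_measure n) rV_of_tuple.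

Let m0 : lebesgue_rV set0 = 0.
Proof. by apply: measure0; exact: measurable_rV_of_tuple. Qed.

Let m_ge0 A : 0 <= lebesgue_rV A.
Proof. by apply: measure_ge0; exact: measurable_rV_of_tuple. Qed.

Let m_sigma_additive : semi_sigma_additive lebesgue_rV.
Proof.
by apply: measure_semi_sigma_additive; exact: measurable_rV_of_tuple.
Qed.

HB.instance Definition _ := isMeasure.Build _ _ _ lebesgue_rV
  m0 m_ge0 m_sigma_additive.

Let m_sigma_finite : sigma_finite setT lebesgue_rV.
Proof.
apply: (@pushforward_sigma_finite _ _ _ _ _ rV_of_tuple
  (fun x : 'rV[R]_n => [tuple x ord0 j | j < n])
  (tuple_measure lebesgue_measure n)); last exact: sigma_finiteT.
  apply/measurable_fun_tnthP => j.
  rewrite (_ : _ \o _ = fun x : 'rV[R]_n => x ord0 j).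
    exact: measurable_coord.
  by apply/funext => x /=; rewrite tnth_mktuple.
by move=> t; apply: eq_from_tnth => j; rewrite tnth_mktuple mxE.
Qed.

HB.instance Definition _ := Measure_isSigmaFinite.Build _ _ _
  lebesgue_rV m_sigma_finite.

End lebesgue_rV.

Section lebesgue_mx.
Local Open Scope ereal_scope.
Context (R : realType) (m n : nat).

Definition mx_of_tuple (t : m.-tuple 'rV[R]_n) : 'M[R]_(m, n) :=
  \matrix_(i, j) tnth t i ord0 j.

Lemma measurable_mx_of_tuple : measurable_fun setT mx_of_tuple.
Proof.
apply/measurable_fun_mxP => i j.
rewrite (_ : (fun _ => _) = (fun x : 'rV[R]_n => x ord0 j) \o (fun t => tnth t i)).
  by apply: measurableT_comp; [exact: measurable_coord|exact: measurable_tnth].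
by apply/funext => t; rewrite mxE.
Qed.

Definition lebesgue_mx : set 'M[R]_(m, n) -> \bar R :=
  pushforward (tuple_measure (@lebesgue_rV R n) m) mx_of_tuple.

Let m0 : lebesgue_mx set0 = 0.
Proof. by apply: measure0; exact: measurable_mx_of_tuple. Qed.

Let m_ge0 A : 0 <= lebesgue_mx A.
Proof. by apply: measure_ge0; exact: measurable_mx_of_tuple. Qed.

Let m_sigma_additive : semi_sigma_additive lebesgue_mx.
Proof.
by apply: measure_semi_sigma_additive; exact: measurable_mx_of_tuple.
Qed.

HB.instance Definition _ := isMeasure.Build _ _ _ lebesgue_mx
  m0 m_ge0 m_sigma_additive.

Let m_sigma_finite : sigma_finite setT lebesgue_mx.
Proof.
apply: (@pushforward_sigma_finite _ _ _ _ _ mx_of_tuple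
  (fun x : 'M[R]_(m, n) => [tuple row i x | i < m])
  (tuple_measure (@lebesgue_rV R n) m)); last exact: sigma_finiteT.
  apply/measurable_fun_tnthP => i.
  apply/measurable_fun_mxP => k j.
  rewrite (_ : (fun _ => _) = fun x : 'M[R]_(m, n) => x i j).
    exact: measurable_coord.
  by apply/funext => x /=; rewrite tnth_mktuple mxE.
by move=> t; apply: eq_from_tnth => i; rewrite tnth_mktuple;
  apply/rowP => j; rewrite !mxE.
Qed.

HB.instance Definition _ := Measure_isSigmaFinite.Build _ _ _
  lebesgue_mx m_sigma_finite.

End lebesgue_mx.

Section box.
Local Open Scope ereal_scope.

Lemma tuple_measure_box d (T : measurableType d) (R : realType)
    (mu : {sigma_finite_measure set T -> \bar R}) n (A : 'I_n -> set T) :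
  (forall i, measurable (A i)) ->
  tuple_measure mu n [set t | forall i, A i (tnth t i)] = \prod_(i < n) mu (A i).
Proof.
elim: n A => [|n IH] A mA.
  by rewrite big_ord0 /= diracE mem_set//= => -[].
rewrite big_ord_recl -IH; last by move=> i; exact: mA.
have mA' : measurable [set t : n.-tuple T | forall i, A (lift ord0 i) (tnth t i)].
  rewrite (_ : [set _ | _] = \bigcap_(i in [set: 'I_n])
      ((fun t : n.-tuple T => tnth t i) @^-1` A (lift ord0 i))).
    apply: fin_bigcap_measurable => // i _.
    by rewrite -[X in measurable X]setTI; exact: measurable_tnth.
  by apply/seteqP; split => [t At i _|t At i]; exact: At.
rewrite -product_measure1E//=; congr product_measure1.
apply/seteqP; split => [[x t] /= At|[x t] /= [Ax At] i].
  split; first exact: (At ord0).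
  by move=> i; have := At (lift ord0 i); rewrite tnthS.
by case: (unliftP ord0 i) => [j|] ->; rewrite ?tnthS//; exact: At.
Qed.

Lemma lebesgue_rV_box (R : realType) n (a b : 'rV[R]_n) :
  (forall j, (a ord0 j <= b ord0 j)%R) ->
  lebesgue_rV [set x : 'rV[R]_n | forall j, x ord0 j \in `[a ord0 j, b ord0 j]%R]
  = (\prod_(j < n) (b ord0 j - a ord0 j))%:E.
Proof.
move=> ab; rewrite -prodEFin /lebesgue_rV /pushforward.
rewrite (_ : _ @^-1` _ = [set t : n.-tuple (measurableTypeR R) |
    forall j, [set` `[a ord0 j, b ord0 j]%R] (tnth t j)]).
  rewrite (@tuple_measure_box _ (measurableTypeR R) R lebesgue_measure n
    (fun j => [set` `[a ord0 j, b ord0 j]%R]))//; apply: eq_bigr => j _.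
  have /= -> := @lebesgue_measure_itv R `[a ord0 j, b ord0 j]%R.
  by rewrite lte_fin; case: ltgtP (ab j) => // ->; rewrite subrr.
by apply/seteqP; split => t /= + j => /(_ j); rewrite mxE.
Qed.

Lemma lebesgue_mx_box (R : realType) m n (a b : 'M[R]_(m, n)) :
  (forall i j, (a i j <= b i j)%R) ->
  lebesgue_mx [set x : 'M[R]_(m, n) | forall i j, x i j \in `[a i j, b i j]%R]
  = (\prod_(i < m) \prod_(j < n) (b i j - a i j))%:E.
Proof.
move=> ab; rewrite -prodEFin /lebesgue_mx /pushforward.
rewrite (_ : _ @^-1` _ = [set t : m.-tuple 'rV[R]_n | forall i,
    [set x : 'rV[R]_n | forall j, x ord0 j \in `[row i a ord0 j, row i b ord0 j]%R]
    (tnth t i)]).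
  rewrite (@tuple_measure_box _ 'rV[R]_n R (@lebesgue_rV R n) m (fun i =>
    [set x : 'rV[R]_n | forall j, x ord0 j \in `[row i a ord0 j, row i b ord0 j]%R])).
    apply: eq_bigr => i _; rewrite [LHS](@lebesgue_rV_box R n (row i a) (row i b)) => [|j]; last by rewrite !mxE.
    by congr EFin; apply: eq_bigr => j _; rewrite !mxE.
  move=> i; rewrite (_ : [set _ | _] = \bigcap_(j in [set: 'I_n])
      ((fun x : 'rV[R]_n => x ord0 j) @^-1` [set` `[row i a ord0 j, row i b ord0 j]%R])).
    apply: fin_bigcap_measurable => // j _.
    by rewrite -[X in measurable X]setTI; exact: measurable_coord.
  by apply/seteqP; split => [t At j _|t At j]; exact: At.
by apply/seteqP; split => t /= + i j => /(_ i j); rewrite !mxE.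
Qed.

End box.

Definition log_concave (R : realType) (V : lmodType R) (f : V -> R) : Prop :=
  forall (x y : V) (l : R), 0 <= l <= 1 ->
    f x `^ (1 - l) * f y `^ l <= f ((1 - l) *: x + l *: y).

Definition upper_semicontinuous (R : realType) (X : topologicalType)
    (f : X -> R) : Prop :=
  forall (x : X) (a : R), f x < a -> \forall y \near x, f y < a.

(* For upper semicontinuous f, which is Borel, integrability with respect to
   the Borel measure lebesgue_rV is Lebesgue integrability. *)
Definition LC (R : realType) (n : nat) (f : 'rV[R]_n -> R) : Prop :=
  [/\ forall x, 0 <= f x,
      log_concave f,
      upper_semicontinuous f,
      (@lebesgue_rV R n).-integrable setT (EFin \o f)
    & ~ {ae @lebesgue_rV R n, forall x, f x = 0}].

Section convolutions.
Context (R : realType) (m n : nat) (f : 'I_m.+1 -> 'rV[R]_n -> R).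

(* A point (x_1, ..., x_m) of (R^n)^m is the m x n matrix with these rows. *)
Definition conv_integrand (x : 'M[R]_(m, n)) (z : 'rV[R]_n) : R :=
  f ord0 z * \prod_(i < m) f (lift ord0 i) (z - row i x).

Definition oplus_conv (x : 'M[R]_(m, n)) : \bar R :=
  (\int[@lebesgue_rV R n]_z (conv_integrand x z)%:E)%E.

Definition star_conv (x : 'M[R]_(m, n)) : \bar R :=
  ereal_sup (range (fun z => (conv_integrand x z)%:E)).

End convolutions.

(* Main.v *)
From HB Require Import structures.
Require Import Defs.
From mathcomp Require Import all_boot all_order all_algebra.
From mathcomp Require Import all_classical all_reals all_analysis ess_sup_inf.
From mathcomp Require Import measurable_realfun ring lra.

Set Implicit Arguments.
Unset Strict Implicit.
Unset Printing Implicit Defensive.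

Import Order.TTheory GRing.Theory Num.Theory.
Import numFieldNormedType.Exports.

Local Open Scope classical_set_scope.
Local Open Scope ring_scope.

(** Write [F (x, z)] for the integrand of the two convolutions, a function on
    [R^(nm) * R^n].  By Tonelli and the invariance of Lebesgue measure under
    [w |-> z - w], its total integral is the product of the integrals of the
    [f i] ([integral_conv_integrand]).  The convolution [oplus_conv] at [x0] is
    the integral of [F] over the fibre of [x0], and [star_conv] is the projection
    (fibrewise supremum) of [F].  So the theorem is a functional form of the
    Rogers-Shephard inequality between a section, a projection and the total
    volume; the two extra facts used about [F] are that it is bounded by the
    product [M] of the suprema of the [f i], and that it is log-concave.

    For a convex set [K] in [X * Z], [dim X = p], [dim Z = n], the inequality is
    [|P| |K_x0| <= 'C(p + n, n) |K|] whenever every point of [P] lies below a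
    point of [K] ([section_projection_le]).  By convexity the fibre of [K] over
    [(1 - r) x + r x0] with [x] in [P] contains a translate of [r K_x0], hence has
    volume at least [r^n |K_x0|] ([section_homothety]); only the scaling of
    Lebesgue measure is needed, not the Brunn-Minkowski inequality.  Integrating
    over the fibres gives
    [|K| >= |K_x0| |P| \int_0^1 n r^(n-1) (1-r)^p dr] for [n > 0], and this Beta
    integral is the inverse of the binomial coefficient ([beta_binomial]).

    To pass to functions ([section_projection_fun_le]), let [h] be a measurable
    function below the projection of [F], and let [g] be the restriction of [F] to
    the fibre of [x0].  The set inequality at each level [u], integrated over [u],
    says that [\int min (h x, g z) dx dz] is at most ['C(p + n, n) \int F].  Since
    [h] and [g] take values in [[0, M]], [h x * g z <= M * min (h x, g z)], which
    turns the left-hand side into the product of the two integrals.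

    The projection [star_conv f] need not be Borel measurable a priori; the
    integral of a nonnegative function is by definition the supremum of the
    integrals of the simple functions below it, so it is enough to work with
    measurable minorants ([integral_mul_le]).  Finally the pointwise bound by the
    essential suprema holds everywhere and not only almost everywhere, by
    log-concavity ([LC_le_ess_sup]). *)

(** * Maps that rescale a measure *)

Section rescaling.
Local Open Scope ereal_scope.

(** Change of variables along [phi], with constant Jacobian [k].  Phrasing it with
    integrals of arbitrary functions makes it pass to products by Tonelli. *)
Definition rescales d (T : measurableType d) (R : realType)
    (mu : set T -> \bar R) (phi : T -> T) (k : R) :=
  [/\ measurable_fun setT phi, (0 <= k)%R &
    forall f : T -> \bar R, measurable_fun setT f -> (forall x, 0 <= f x) ->
      k%:E * \int[mu]_x f (phi x) = \int[mu]_x f x].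

Lemma lebesgue_rescales (R : realType) (c d : R) : c != 0%R ->
  rescales (@lebesgue_measure R) (fun x => d + c * x)%R `|c|%R.
Proof.
move=> c0; have k0 : (0 <= `|c|)%R by [].
have kgt0 : (0 < `|c|)%R by rewrite normr_gt0.
have mphi : measurable_fun setT ((fun x => d + c * x)%R : measurableTypeR R -> measurableTypeR R).
  by apply: measurable_funD => //; apply: measurable_funM.
split => //.
move=> f mf f0.
pose phi : measurableTypeR R -> measurableTypeR R := (fun x => d + c * x)%R.
pose nu_ : {measure set (measurableTypeR R) -> \bar R} :=
  mscale (NngNum k0) (pushforward (@lebesgue_measure R) phi).
pose nu := nu_ mphi.
transitivity (\int[nu]_x f x); last first.
  apply: eq_measure_integral => A mA _; apply/esym.
  apply: lebesgue_measure_unique => //= _ [[a b]] _ <-.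
  rewrite /nu /nu_ /mscale/= /pushforward.
  have key (a' b' : R) : (a' < b')%R = (a < b)%R -> (b' - a' = (b - a) / `|c|)%R ->
      (if (a%:E < b%:E)%E then b%:E - a%:E else 0) =
      `|c|%:E * (if (a'%:E < b'%:E)%E then b'%:E - a'%:E else 0).
    move=> e1 e2; rewrite !lte_fin e1; case: ifP => _; last by rewrite mule0.
    by rewrite -!EFinB e2 -EFinM mulrC divfK// normr_eq0.
  have [cp|cn|] := ltgtP c 0%R; last by move/eqP; rewrite (negbTE c0).
  - have -> : (phi @^-1` [set` `]a, b]%R] = [set` `[(b - d) / c, (a - d) / c[%R]).
      apply/seteqP; split => x /=; rewrite !in_itv/= ?ler_ndivrMr ?ltr_ndivlMr//.
        by rewrite lerBrDl ltrBlDl mulrC andbC.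
      by rewrite lerBrDl ltrBlDl mulrC andbC.
    rewrite !lebesgue_measure_itv/=; apply: key.
      by rewrite ltr_nM2r ?invr_lt0// ltrD2r.
    rewrite ltr0_norm//; field; exact: c0.
  - have -> : (phi @^-1` [set` `]a, b]%R] = [set` `](a - d) / c, (b - d) / c]%R]).
      apply/seteqP; split => x /=; rewrite !in_itv/= ?ler_pdivlMr ?ltr_pdivrMr//.
        by rewrite lerBrDl ltrBlDl mulrC.
      by rewrite lerBrDl ltrBlDl mulrC.
    rewrite !lebesgue_measure_itv/=; apply: key.
      by rewrite ltr_pM2r ?invr_gt0// ltrD2r.
    rewrite gtr0_norm//; field; exact: c0.
rewrite ge0_integral_mscale//=; congr *%E.
by rewrite ge0_integral_pushforward.
Qed.

(** The maps may differ from one factor to the next: this is what covers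
    translations by an arbitrary vector. *)
Lemma tuple_rescales d (T : measurableType d) (R : realType)
    (mu : {sigma_finite_measure set T -> \bar R}) n (phi : 'I_n -> T -> T) k :
  (forall i, rescales mu (phi i) k) ->
  rescales (tuple_measure mu n)
    (fun t => [tuple phi i (tnth t i) | i < n]) (k ^+ n)%R.
Proof.
elim: n phi => [|n IH] phi H.
  split => //.
    apply/measurable_fun_tnthP => -[]//.
  move=> f mf f0 /=; rewrite expr0 mul1e; apply: eq_integral => t _.
  by congr f; rewrite tuple0; apply/esym; rewrite tuple0.
have k0 : (0 <= k)%R by have [] := H ord0.
have mphi0 i : measurable_fun setT (phi i) by have [] := H i.
have mphi : measurable_fun setT (fun t : n.+1.-tuple T => [tuple phi i (tnth t i) | i < n.+1]).
  apply/measurable_fun_tnthP => i.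
  rewrite (_ : _ \o _ = phi i \o (fun t => tnth t i)).
    by apply: measurableT_comp => //; exact: measurable_tnth.
  by apply/funext => t /=; rewrite tnth_mktuple.
have [m1 k1 IH'] := IH (fun i => phi (lift ord0 i)) (fun i => H (lift ord0 i)).
split => // [|f mf f0]; first exact: exprn_ge0.
have mc := @measurable_tuple_cons _ T n.
have mg := measurableT_comp mf mphi.
pose nu := tuple_measure mu n.
pose phi' (t : n.-tuple T) := [tuple phi (lift ord0 i) (tnth t i) | i < n].
have E x t : [tuple phi i (tnth (tuple_cons (x, t)) i) | i < n.+1] =
    tuple_cons (phi ord0 x, phi' t).
  apply: eq_from_tnth => i; rewrite tnth_mktuple.
  case: (unliftP ord0 i) => [j|] ->; last by rewrite !(tnth_nth x).
  by rewrite /tuple_cons/= !tnthS tnth_mktuple.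
rewrite /= /tuple_cons_measure.
rewrite (ge0_integral_pushforward mc)// (ge0_integral_pushforward mc)//.
rewrite preimage_setT.
have mgc := measurableT_comp mg mc; have mfc := measurableT_comp mf mc.
rewrite (fubini_tonelli1 _ mgc); last by move=> x; exact: f0.
rewrite (fubini_tonelli1 _ mfc); last by move=> x; exact: f0.
rewrite /fubini_F/=.
under eq_integral do under eq_integral do rewrite E.
have mF x : measurable_fun setT (fun t => f (tuple_cons (x, t))).
  by apply: (measurableT_comp (measurableT_comp mf mc)); exact: measurable_pair1.
have mI : measurable_fun setT (fun x => \int[nu]_t f (tuple_cons (x, t))).
  apply: (@measurable_fun_fubini_tonelli_F _ _ _ _ _ nu _ mfc) => x; exact: f0.
have I0 x : 0 <= \int[nu]_t f (tuple_cons (x, t)) by apply: integral_ge0.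
have mJ : measurable_fun setT
    (fun x => \int[nu]_t f (tuple_cons (phi ord0 x, phi' t))).
  apply: (@measurable_fun_fubini_tonelli_F _ _ _ _ _ nu
    (fun p => f (tuple_cons (phi ord0 p.1, phi' p.2)))) => [|x]; last exact: f0.
  apply: (measurableT_comp mfc).
  apply/measurable_fun_pairP; split => /=.
    exact: (measurableT_comp (mphi0 _) measurable_fst).
  exact: (measurableT_comp m1 measurable_snd).
rewrite exprS EFinM -muleA -(ge0_integralZl_EFin _ _ _ mJ)//; last first.
  by move=> x _; exact: integral_ge0.
transitivity (k%:E * \int[mu]_x \int[nu]_t f (tuple_cons (phi ord0 x, t))).
  congr (_ * _); apply: eq_integral => x _.
  exact: (IH' (fun t => f (tuple_cons (phi ord0 x, t))) (mF _)).
by have [_ _ /(_ _ mI I0)] := H ord0.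
Qed.

Lemma pushforward_rescales d1 d2 (T1 : measurableType d1)
    (T2 : measurableType d2) (R : realType) (mu : {measure set T1 -> \bar R})
    (h : T1 -> T2) (phi1 : T1 -> T1) (phi2 : T2 -> T2) (k : R) :
  measurable_fun setT h -> measurable_fun setT phi2 ->
  (forall x, h (phi1 x) = phi2 (h x)) ->
  rescales mu phi1 k -> rescales (pushforward mu h) phi2 k.
Proof.
move=> mh mphi hphi [m1 k0 H]; split => // f mf f0.
have mfp := measurableT_comp mf mphi.
rewrite (ge0_integral_pushforward mh _ _ mfp)//; last first.
  by move=> y _; exact: f0.
rewrite (ge0_integral_pushforward mh)//.
rewrite preimage_setT -(H _ (measurableT_comp mf mh)); last by move=> x; exact: f0.
by congr *%E; apply: eq_integral => x _ /=; rewrite hphi.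
Qed.

Lemma rV_rescales (R : realType) n (c : R) (v : 'rV[R]_n) : c != 0%R ->
  rescales (@lebesgue_rV R n) (fun x => v + c *: x)%R (`|c| ^+ n)%R.
Proof.
move=> c0.
pose mu := tuple_measure (@lebesgue_measure R) n.
pose phi (t : n.-tuple (measurableTypeR R)) : n.-tuple (measurableTypeR R) :=
  [tuple (v ord0 j + c * tnth t j)%R | j < n].
apply: (@pushforward_rescales _ _ _ _ _ mu _ phi _ _
  (@measurable_rV_of_tuple R n)).
- apply/measurable_fun_mxP => i j; under eq_fun do rewrite !mxE.
  apply: measurable_funD => //; apply: measurable_funM => //.
  exact: measurable_coord.
- by move=> t; apply/rowP => j; rewrite !mxE tnth_mktuple.
- apply: (@tuple_rescales _ _ _ lebesgue_measure n
    (fun j x => v ord0 j + c * x)%R) => j.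
  exact: lebesgue_rescales.
Qed.

Lemma mx_rescales (R : realType) m n (c : R) (v : 'M[R]_(m, n)) : c != 0%R ->
  rescales (@lebesgue_mx R m n) (fun x => v + c *: x)%R (`|c| ^+ (n * m))%R.
Proof.
move=> c0; rewrite exprM.
pose mu := tuple_measure (@lebesgue_rV R n) m.
pose phi (t : m.-tuple 'rV[R]_n) : m.-tuple 'rV[R]_n :=
  [tuple (row i v + c *: tnth t i)%R | i < m].
apply: (@pushforward_rescales _ _ _ _ _ mu _ phi _ _
  (@measurable_mx_of_tuple R m n)).
- apply/measurable_fun_mxP => i j; under eq_fun do rewrite !mxE.
  apply: measurable_funD => //; apply: measurable_funM => //.
  exact: measurable_coord.
- by move=> t; apply/matrixP => i j; rewrite !mxE tnth_mktuple !mxE.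
- apply: (@tuple_rescales _ _ _ (@lebesgue_rV R n) m
    (fun i x => row i v + c *: x)%R) => i.
  exact: rV_rescales.
Qed.

Lemma rescales_measure d (T : measurableType d) (R : realType)
    (mu : {measure set T -> \bar R}) (phi : T -> T) (k : R) (K : set T) :
  rescales mu phi k -> measurable K -> k%:E * mu (phi @^-1` K) = mu K.
Proof.
move=> [mphi k0 H] mK.
have mphiK : measurable (phi @^-1` K).
  by rewrite -[X in measurable X]setTI; exact: mphi.
have := H (fun x => (\1_K x)%:E).
rewrite integral_indic// setIT => <-//; last exact/measurable_EFinP.
by rewrite -[in LHS](setIT (phi @^-1` K)) -integral_indic.
Qed.

End rescaling.

(** * Complements on integration *)

Section integration.
Local Open Scope ereal_scope.

Lemma tuple_integral_prod d (T : measurableType d) (R : realType)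
    (mu : {sigma_finite_measure set T -> \bar R}) n (g : 'I_n -> T -> R) :
  (forall i, measurable_fun setT (g i)) -> (forall i x, 0 <= g i x)%R ->
  \int[tuple_measure mu n]_t (\prod_(i < n) g i (tnth t i))%:E =
  \prod_(i < n) \int[mu]_x (g i x)%:E.
Proof.
elim: n g => [|n IH] g mg g0.
  rewrite big_ord0 /=; under eq_integral do rewrite big_ord0.
  by rewrite integral_cst//= diracE mem_set// mule1.
have mp k (h : 'I_k -> 'I_n.+1) :
    measurable_fun setT (fun t : k.-tuple T => (\prod_(i < k) g (h i) (tnth t i))%:E).
  apply/measurable_EFinP; apply: measurable_prod => i _.
  exact: (measurableT_comp (mg _) (@measurable_tnth _ _ _ i)).
have mc := @measurable_tuple_cons _ T n.
have p0 (k : nat) (h : 'I_k -> 'I_n.+1) (t : k.-tuple T) :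
    0 <= (\prod_(i < k) g (h i) (tnth t i))%:E.
  by rewrite lee_fin; apply: prodr_ge0 => i _.
rewrite /= /tuple_cons_measure.
have mp1 := mp _ id.
rewrite (ge0_integral_pushforward mc _ _ mp1)//.
rewrite preimage_setT.
rewrite (fubini_tonelli1 _ (measurableT_comp mp1 mc)); last by move=> x; exact: (p0 _ id).
have mp2 := mp n (fun i => lift ord0 i); have p2 := p0 n (fun i => lift ord0 i).
rewrite big_ord_recl -IH// -ge0_integralZr//; last 3 first.
- exact/measurable_EFinP.
- by move=> x _; rewrite lee_fin.
- exact: integral_ge0.
apply: eq_integral => x _; rewrite /fubini_F /= -ge0_integralZl ?lee_fin//.
apply: eq_integral => t _; rewrite big_ord_recl -EFinM.
by congr (_ * _)%:E; apply: eq_bigr => i _; rewrite tnthS.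
Qed.

(** Packaging the product measure makes [layer_cake] applicable to it. *)
Definition product_sigma_finite_measure d1 d2 (T1 : measurableType d1) (T2 : measurableType d2)
    (R : realType) (m1 : {sigma_finite_measure set T1 -> \bar R})
    (m2 : {sigma_finite_measure set T2 -> \bar R}) :
    {sigma_finite_measure set (T1 * T2)%type -> \bar R} :=
  HB.pack (m1 \x m2)
    (Measure_isSigmaFinite.Build _ _ _ (m1 \x m2) (product_sigma_finite m1 m2)).

Lemma product_integral d1 d2 (T1 : measurableType d1)
    (T2 : measurableType d2) (R : realType)
    (m1 : {sigma_finite_measure set T1 -> \bar R})
    (m2 : {sigma_finite_measure set T2 -> \bar R}) (f : T1 -> R) (g : T2 -> R) :
  measurable_fun setT f -> measurable_fun setT g ->
  (forall x, 0 <= f x)%R -> (forall x, 0 <= g x)%R ->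
  \int[m1 \x m2]_p (f p.1 * g p.2)%:E =
  \int[m1]_x (f x)%:E * \int[m2]_y (g y)%:E.
Proof.
move=> mf mg f0 g0.
rewrite fubini_tonelli1; last 2 first.
- apply/measurable_EFinP; apply: measurable_funM.
    exact: (measurableT_comp mf measurable_fst).
  exact: (measurableT_comp mg measurable_snd).
- by move=> p; rewrite lee_fin mulr_ge0.
rewrite -ge0_integralZr//; last 3 first.
- exact/measurable_EFinP.
- by move=> x _; rewrite lee_fin.
- by apply: integral_ge0 => y _; rewrite lee_fin.
apply: eq_integral => x _; rewrite /fubini_F /= -ge0_integralZl//.
- exact/measurable_EFinP.
- by move=> y _; rewrite lee_fin.
- by rewrite lee_fin.
Qed.

Lemma measurable_superlevel d (T : measurableType d) (R : realType)
    (mu : {sigma_finite_measure set T -> \bar R}) (f : T -> R) :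
  measurable_fun setT f ->
  measurable_fun setT (fun u : measurableTypeR R => mu [set x | (u < f x)%R]).
Proof.
move=> mf.
pose A := [set p : T * measurableTypeR R | (p.2 < f p.1)%R].
have mA : measurable A.
  rewrite -[X in measurable X]setTI.
  apply: (measurable_fun_ltr measurable_snd _ measurableT (Y := [set true])) => //.
  exact: (measurableT_comp mf measurable_fst).
have := measurable_fun_ysection mu mA.
congr measurable_fun; apply/funext => u /=; congr (mu _).
by apply/seteqP; split => x; rewrite /ysection/= inE.
Qed.

(** Both sides are the volume of the region [0 <= u < f x] below the graph of [f],
    computed by integrating first in [u] or first in [x]. *)
Lemma layer_cake d (T : measurableType d) (R : realType)
    (mu : {sigma_finite_measure set T -> \bar R}) (f : T -> R) :
  measurable_fun setT f -> (forall x, 0 <= f x)%R ->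
  \int[mu]_x (f x)%:E =
  \int[@lebesgue_measure R]_(u in `[0%R, +oo[) mu [set x | (u < f x)%R].
Proof.
move=> mf f0.
pose A := [set p : T * measurableTypeR R | (0 <= p.2)%R /\ (p.2 < f p.1)%R].
have mA : measurable A.
  rewrite (_ : A = (fun p => 0 <= p.2)%R @^-1` [set true] `&`
      (fun p => p.2 < f p.1)%R @^-1` [set true])//.
  apply: measurableI.
    rewrite -[X in measurable X]setTI.
    by apply: (measurable_fun_ler _ measurable_snd).
  rewrite -[X in measurable X]setTI.
  apply: (measurable_fun_ltr measurable_snd) => //.
  exact: measurableT_comp.
have /esym H := indic_fubini_tonelli mu (@lebesgue_measure R) mA.
rewrite indic_fubini_tonelli_FE// indic_fubini_tonelli_GE// in H.
rewrite [RHS]integral_mkcond/=.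
transitivity (\int[mu]_x (lebesgue_measure \o xsection A) x).
  apply: eq_integral => x _ /=.
  rewrite (_ : xsection A x = `[0%R, f x[%classic).
    rewrite lebesgue_measure_itv/= lte_fin oppr0 adde0.
    by rewrite lt_neqAle f0 andbT eq_sym; case: eqVneq => //= ->.
  rewrite /A; apply/seteqP; split => u /=; rewrite /xsection/= inE in_itv/=.
    by move=> [-> ->].
  by move=> /andP[].
rewrite -H; apply: eq_integral => u _.
rewrite patchE /=; have [u0|u0] := leP 0%R u.
  rewrite mem_set/=; last by rewrite in_itv/= u0.
  congr (mu _); apply/seteqP; split => x /=; rewrite /ysection/= inE /A/=.
    by case.
  by [].
rewrite memNset/=; last by rewrite in_itv/= leNgt u0.
rewrite (_ : ysection _ _ = set0) ?measure0//.
by apply/seteqP; split => x //=; rewrite /ysection/= inE /A/= leNgt u0 => -[].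
Qed.

Lemma mul_ereal_sup_le (R : realType) (S : set (\bar R)) (a T : \bar R) :
  0 <= a -> 0 <= T -> (forall y, S y -> y * a <= T) -> ereal_sup S * a <= T.
Proof.
move=> a0 T0 H; have [S0|S0] := leP (ereal_sup S) 0.
  by rewrite (le_trans _ T0)// mule_le0_ge0.
case: a a0 H => [a||] // a0 H.
  move: a0; rewrite lee_fin le_eqVlt => /predU1P[<-|a0]; first by rewrite mule0.
  rewrite -lee_pdivlMr//; apply/ereal_supP => y Sy.
  by rewrite lee_pdivlMr// H.
have /ereal_sup_gt[y Sy y0] := S0.
by have := H _ Sy; rewrite gt0_muley// leye_eq => /eqP ->; rewrite leey.
Qed.

Import HBNNSimple.

(** The integral of a nonnegative function, measurable or not, is the lower one,
    so a bound for all measurable minorants of [g] is a bound for [g]. *)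
Lemma integral_mul_le (R : realType) d (T : measurableType d) (mu : {measure set T -> \bar R})
    (g : T -> \bar R) (a b : \bar R) :
  (forall x, 0 <= g x) -> 0 <= a -> 0 <= b ->
  (forall h : T -> R, measurable_fun setT h -> (forall x, 0 <= h x)%R ->
     (forall x, (h x)%:E <= g x) -> \int[mu]_x (h x)%:E * a <= b) ->
  \int[mu]_x g x * a <= b.
Proof.
move=> g0 a0 b0 H; rewrite ge0_integralTE//.
apply: mul_ereal_sup_le => // _ [h hg <-].
by have := H h; rewrite integral_nnsfun// patch_setT; apply.
Qed.

Lemma integral_exprn (R : realType) n (s : R) : (0 <= s)%R ->
  \int[@lebesgue_measure R]_(r in `[0%R, s]) (n.+1%:R * r ^+ n)%:E = (s ^+ n.+1)%:E.
Proof.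
rewrite le_eqVlt => /predU1P[<-|s0].
  by rewrite set_itv1 integral_set1 expr0n.
rewrite (@continuous_FTC2 R _ (fun x => x ^+ n.+1)%R)//.
- by rewrite expr0n/= sube0.
- apply: continuous_in_subspaceT => x _.
  by apply: cvgM; [exact: cvg_cst|exact: exprn_continuous].
- split.
  + by move=> x _; exact: exprn_derivable.
  + exact/cvg_at_right_filter/exprn_continuous.
  + exact/cvg_at_left_filter/exprn_continuous.
- by move=> x _; rewrite derive1E exp_derive scaler1.
Qed.

(** This is [n.+1] times the Beta integral [B(n.+1, p.+1)]. *)
Lemma beta_binomial (R : realType) p n :
  \int[@lebesgue_measure R]_(r in `]0%R, 1%R[) (n.+1%:R * r ^+ n * (1 - r) ^+ p)%:E
  = ('C(p + n.+1, n.+1)%:R^-1)%:E.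
Proof.
have H : (\int[@lebesgue_measure R]_(r in `]0%R, 1%R[) (r ^+ n * (1 - r) ^+ p)%:E)
  = (beta_fun n.+1 p.+1)%:E.
  rewrite EFin_beta_fun /= -(@integral_itv_bndoo _ _ _ _ true false); last first.
    apply/measurable_EFinP; exact: (@measurable_XMonemX R _ n p).
  by rewrite integral_mkcond; apply: eq_integral => x _ /=; rewrite restrict_EFin.
under eq_integral do rewrite -mulrA EFinM.
rewrite ge0_integralZl_EFin//; last 2 first.
- move=> x /=; rewrite in_itv/= => /andP[x0 x1].
  by rewrite lee_fin mulr_ge0// exprn_ge0// ?subr_ge0 ltW.
- apply/measurable_EFinP; exact: (@measurable_XMonemX R _ n p).
rewrite H -EFinM beta_fun_fact; congr EFin.
have -> : (n + p).+1 = (p + n.+1)%N by rewrite addnS addnC.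
have e : ((p + n.+1)`! = 'C(p + n.+1, n.+1) * (n.+1 * (n`! * p`!)))%N.
  by rewrite -(bin_fact (leq_addl p n.+1)) addnK factS; congr muln; rewrite -mulnA.
rewrite e (natrM _ 'C(_, _)) (natrM _ n.+1) (natrM _ n`!).
have b0 : ('C(p + n.+1, n.+1)%:R != 0 :> R)%R.
  by rewrite pnatr_eq0 -lt0n bin_gt0 leq_addl.
have f1 k : (k`!%:R != 0 :> R)%R by rewrite pnatr_eq0 -lt0n fact_gt0.
have n1 : (n.+1%:R != 0 :> R)%R by rewrite pnatr_eq0.
move: ('C(p + n.+1, n.+1)%:R : R) (n`!%:R : R) (p`!%:R : R) (n.+1%:R : R)
  b0 (f1 n) (f1 p) n1 => c x y z c0 x0 y0 z0.
by field; rewrite c0 x0 y0 z0.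
Qed.

(** When [b] is positive and [b] and [N] are finite, the bound
    [r ^+ n.+1 * b <= N] confines [E] to the interval from [0] to the [n.+1]-th
    root [s] of [N / b], on which the integral is [s ^+ n.+1]. *)
Lemma mul_integral_exprn_le (R : realType) n (E : set (measurableTypeR R)) (b N : \bar R) :
  measurable E -> (forall r, E r -> 0 < r)%R -> 0 <= b -> 0 <= N ->
  (forall r, E r -> (r ^+ n.+1)%:E * b <= N) ->
  b * \int[@lebesgue_measure R]_(r in E) (n.+1%:R * r ^+ n)%:E <= N.
Proof.
move=> mE E0 b0 N0 H.
have [->|/set0P[r0 Er0]] := eqVneq E set0; first by rewrite integral_set0 mule0.
have r00 := E0 _ Er0; have Hr0 := H _ Er0.
move: b N b0 N0 H Hr0 => [b||] [N||]// b0 N0 H Hr0; last 3 first.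
- by rewrite leey.
- by move: Hr0; rewrite gt0_muley// lte_fin exprn_gt0.
- by rewrite leey.
have [->|bn0] := eqVneq b 0%R; first by rewrite mul0e.
have bp : (0 < b)%R by rewrite lt_neqAle eq_sym bn0.
have N0' : (0 <= N)%R by [].
pose s := ((N / b) `^ (n.+1%:R^-1))%R.
have s0 : (0 <= s)%R by exact: powR_ge0.
have sn : (s ^+ n.+1 = N / b)%R.
  rewrite -powR_mulrn// /s -powRrM mulVf ?pnatr_eq0// powRr1//.
  by rewrite divr_ge0// ltW.
have Es : E `<=` `[0%R, s].
  move=> r Er; rewrite /= in_itv/= (ltW (E0 _ Er))/=.
  rewrite -(@ler_pXn2r _ n.+1)// ?nnegrE//; last exact: ltW (E0 _ Er).
  by rewrite sn ler_pdivlMr//; have := H _ Er; rewrite -EFinM lee_fin.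
rewrite -lee_pdivlMl// -EFinM [(b^-1 * N)%R]mulrC -sn -integral_exprn//.
apply: ge0_subset_integral => //.
- apply/measurable_EFinP; apply: measurable_funM => //.
- by move=> r; rewrite /= in_itv/= => /andP[r1 _]; rewrite lee_fin mulr_ge0// exprn_ge0.
Qed.

End integration.

(** * Sections and projections of convex sets *)

Section section_projection.
Local Open Scope ereal_scope.

Definition convex_prod (R : realType) (V W : lmodType R) (K : set (V * W)) :=
  forall p q t, (0 <= t <= 1)%R -> K p -> K q ->
    K ((1 - t) *: p.1 + t *: q.1, (1 - t) *: p.2 + t *: q.2)%R.

(** If [z] lies in the fibre over [x], convexity puts the homothetic image
    [(1 - r) z + r K_x0] of the fibre over [x0] into the fibre over
    [(1 - r) x + r x0]. *)
Lemma section_homothety (R : realType) m k n (K : set ('M[R]_(m, k) * 'rV[R]_n))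
    (x0 x : 'M[R]_(m, k)) (r : R) :
  measurable K -> convex_prod K ->
  (0 < r < 1)%R -> (exists z, K (x, z)) ->
  (r ^+ n)%:E * lebesgue_rV (xsection K x0) <=
  lebesgue_rV (xsection K ((1 - r) *: x + r *: x0)%R).
Proof.
move=> mK cK /andP[r0 r1] [z Kz].
have rr := rV_rescales ((1 - r) *: z)%R (lt0r_neq0 r0).
rewrite (gtr0_norm r0) in rr.
have mK' y : measurable (xsection K y) by exact: measurable_xsection.
rewrite -(rescales_measure rr (mK' ((1 - r) *: x + r *: x0)%R)).
apply: lee_wpmul2l; first by rewrite lee_fin exprn_ge0// ltW.
apply: le_measure; rewrite ?inE//.
  by rewrite -[X in measurable X]setTI; case: rr => + _ _; apply.
move=> w; rewrite /xsection/= !inE => Kw.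
by apply: (cK (x, z) (x0, w) r) => //; rewrite (ltW r0) (ltW r1).
Qed.

(** In dimension [0] the weight [n r^(n-1)] degenerates, but fibres are empty or a
    single point of mass one, and [P] lies in the set of nonempty fibres. *)
Lemma section_projection_le0 (R : realType) m k
    (K : set ('M[R]_(m, k) * 'rV[R]_0)) (P : set 'M[R]_(m, k)) x0 :
  measurable K -> measurable P -> (forall x, P x -> exists z, K (x, z)) ->
  lebesgue_mx P * lebesgue_rV (xsection K x0) <=
  (@lebesgue_mx R m k \x @lebesgue_rV R 0) K.
Proof.
move=> mK mP PK.
have nT : @lebesgue_rV R 0 setT = 1.
  have := @lebesgue_rV_box R 0 0%R 0%R; rewrite big_ord0 => <- => [|[]//].
  by congr (lebesgue_rV _); apply/seteqP; split => // x _ [].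
have mK' y : measurable (xsection K y) by exact: measurable_xsection.
apply: (@le_trans _ _ (lebesgue_mx P)).
  rewrite -[leRHS]mule1 -nT; apply: lee_wpmul2l => //.
  by apply: le_measure; rewrite ?inE.
rewrite /product_measure1 -[P in leLHS]setIT.
rewrite -(@integral_indic _ _ _ (@lebesgue_mx R m k) _ measurableT _ mP).
apply: ge0_le_integral => //.
- exact/measurable_EFinP.
- exact: measurable_fun_xsection.
move=> x _ /=; rewrite indicE; have [|_] := boolP (x \in P); last exact: measure_ge0.
rewrite inE => /PK[z Kz].
rewrite (_ : xsection K x = setT) ?nT//.
by apply/seteqP; split => // w _; rewrite /xsection/= inE (thinmx0 w) -(thinmx0 z).
Qed.

(** With [q = n.+1] and [p = k * m], the fibre over [y] satisfies
    [|K_x0| \int q r^(q-1) dr <= |K_y|], the integral ranging over the [r] strictly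
    between [0] and [1] for which [y] is in the image of [P] under the homothety
    of centre [x0] and ratio [1 - r].  Integrating over [y] and exchanging the
    integrals makes the volume [(1 - r)^p |P|] of that image appear. *)
Lemma section_projection_leS (R : realType) m k n
    (K : set ('M[R]_(m, k) * 'rV[R]_n.+1)) (P : set 'M[R]_(m, k)) x0 :
  measurable K -> measurable P -> convex_prod K ->
  (forall x, P x -> exists z, K (x, z)) ->
  lebesgue_mx P * lebesgue_rV (xsection K x0) <=
  'C(k * m + n.+1, n.+1)%:R%:E * (@lebesgue_mx R m k \x @lebesgue_rV R n.+1) K.
Proof.
move=> mK mP cK PK.
pose X := 'M[R]_(m, k).
pose b := (@lebesgue_rV R n.+1) (xsection K x0); pose N y := (@lebesgue_rV R n.+1) (xsection K y).
(* T (y, r) is the point x for which y = (1 - r) x + r x0; writing the inverse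
   of 1 - r as a power makes T visibly measurable in r. *)
pose T (p : X * measurableTypeR R) : X := (x0 + (1 - p.2) `^ (-1) *: (p.1 - x0))%R.
pose S := [set p : X * measurableTypeR R | (0 < p.2 < 1)%R /\ P (T p)].
pose w (r : R) := (n.+1%:R * r ^+ n)%R.
have mT : measurable_fun setT T.
  apply/measurable_fun_mxP => i j; rewrite /T.
  under eq_fun do rewrite !mxE.
  apply: measurable_funD => //; apply: measurable_funM.
    apply: (measurableT_comp (measurable_powR _)).
    by apply: measurable_funB => //; exact: measurable_snd.
  apply: measurable_funB => //.
  exact: (measurableT_comp (measurable_coord i j) measurable_fst).
have mS : measurable S.
  rewrite (_ : S = snd @^-1` [set` `]0%R, 1%R[%R] `&` T @^-1` P); last first.
    by apply/seteqP; split => p /=; rewrite in_itv.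
  apply: measurableI.
    by rewrite -[X in measurable X]setTI; exact: measurable_snd.
  by rewrite -[X in measurable X]setTI; exact: mT.
have mw D : measurable_fun D (w : measurableTypeR R -> R).
  by apply: measurable_funM => //; exact: measurable_funX.
pose g (p : X * measurableTypeR R) := (w p.2 * \1_S p)%:E.
have g0 p : 0 <= g p.
  rewrite /g lee_fin indicE; case: (boolP (p \in S)) => [|_]; last by rewrite mulr0.
  rewrite inE => -[/andP[p0 _] _].
  by rewrite mulr1 mulr_ge0// exprn_ge0// ltW.
have mg : measurable_fun setT g.
  apply/measurable_EFinP; apply: measurable_funM.
    exact: (measurableT_comp (mw setT) measurable_snd).
  exact: measurable_indic.
have TE y r : (r < 1)%R -> ((1 - r) *: T (y, r) + r *: x0 = y)%R.
  move=> r1; have r1' : (0 < 1 - r)%R by rewrite subr_gt0.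
  rewrite /T/= powR_inv1 ?ltW// scalerDr scalerA divff ?gt_eqF// scale1r.
  rewrite scalerBl scale1r addrC addrA [(r *: x0 + _)%R]addrC subrK.
  by rewrite addrC subrK.
have b0 : 0 <= b by exact: measure_ge0.
have N0 y : 0 <= N y by exact: measure_ge0.
(* The fibre over y has volume at least r ^+ n.+1 * b for each r such that
   T (y, r) is in P. *)
have IN y : b * \int[@lebesgue_measure R]_r g (y, r) <= N y.
  rewrite (_ : \int[_]_r _ = \int[@lebesgue_measure R]_(r in xsection S y) (w r)%:E); last first.
    rewrite [RHS]integral_mkcond; apply: eq_integral => r _.
    rewrite /g patchE mem_xsection indicE /=.
    by case: ifPn => _; rewrite ?mulr1 ?mulr0.
  apply: mul_integral_exprn_le => //.
  - exact: measurable_xsection.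
  - by move=> r; rewrite /xsection/= inE => -[/andP[]].
  move=> r; rewrite /xsection/= inE => -[/= r01 PT].
  have r1 : (r < 1)%R by case/andP: r01.
  by rewrite /N -(TE y r r1); apply: section_homothety => //; exact: PK.
have mN : measurable_fun setT N by exact: measurable_fun_xsection.
have mI : measurable_fun setT (fun y => \int[@lebesgue_measure R]_r g (y, r)).
  exact: (@measurable_fun_fubini_tonelli_F _ _ _ _ _ (@lebesgue_measure R) _ mg g0).
have I0 y : 0 <= \int[@lebesgue_measure R]_r g (y, r) by exact: integral_ge0.
have : b * \int[@lebesgue_mx R m k]_y \int[@lebesgue_measure R]_r g (y, r) <=
    ((@lebesgue_mx R m k) \x (@lebesgue_rV R n.+1)) K.
  rewrite -ge0_integralZl//; apply: ge0_le_integral => //.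
  - by move=> y _; exact: mule_ge0.
  - exact: measurable_funeM.
rewrite (@fubini_tonelli _ _ _ _ _ (@lebesgue_mx R m k) (@lebesgue_measure R) g mg g0).
have -> : \int[@lebesgue_measure R]_r \int[@lebesgue_mx R m k]_y g (y, r) =
    (@lebesgue_mx R m k) P * ('C(k * m + n.+1, n.+1)%:R^-1)%:E.
  rewrite -beta_binomial -ge0_integralZl//; last 2 first.
  - apply/measurable_EFinP; apply: measurable_funM; first exact: mw.
    by apply: measurable_funX; exact: measurable_funB.
  - move=> r; rewrite /= in_itv/= => /andP[r0 r1].
    by rewrite lee_fin !mulr_ge0// exprn_ge0// ?subr_ge0 ltW.
  rewrite [RHS]integral_mkcond; apply: eq_integral => r _.
  rewrite patchE; have [r01|r01] := boolP (0 < r < 1)%R; last first.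
    rewrite memNset/=; last by rewrite in_itv; exact/negP.
    apply: integral0_eq => y _; rewrite /g indicE memNset ?mulr0// => -[/= r01'].
    by rewrite r01' in r01.
  rewrite mem_set/=; last by rewrite in_itv.
  have [r0 r1] := andP r01; have r1' : (0 < 1 - r)%R by rewrite subr_gt0.
  (* A is the image of P under the homothety of centre x0 and ratio 1 - r. *)
  pose A := [set y | P (T (y, r))].
  have mA : measurable A.
    rewrite -[A]setTI.
    exact: (measurableT_comp mT (measurable_pair2 r)).
  rewrite (_ : \int[@lebesgue_mx R m k]_y g (y, r) = (w r)%:E * (@lebesgue_mx R m k) A); last first.
    rewrite -[in RHS](setIT A) -integral_indic// -ge0_integralZl//; last 2 first.
    - exact/measurable_EFinP.
    - by rewrite lee_fin mulr_ge0// exprn_ge0// ltW.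
    apply: eq_integral => y _; rewrite /g /= EFinM !indicE.
    suff -> : ((y, r) \in S) = (y \in A) by [].
    by apply/idP/idP; rewrite !inE /S /A /=; [case|split].
  have := mx_rescales (r *: x0)%R (lt0r_neq0 r1').
  rewrite (gtr0_norm r1') => /rescales_measure/(_ mA) <-.
  rewrite (_ : _ @^-1` A = P); last first.
    have Tx x : T ((r *: x0 + (1 - r) *: x)%R, r) = x.
      rewrite /T /= powR_inv1 ?ltW//.
      have -> : (r *: x0 + (1 - r) *: x - x0 = (1 - r) *: (x - x0))%R.
        by apply/matrixP => i j; rewrite !mxE; ring.
      by rewrite scalerA mulVf ?gt_eqF// scale1r addrC subrK.
    by apply/seteqP; split => x; rewrite /A /= Tx.
  by rewrite muleA -EFinM muleC.
move=> H; rewrite -lee_pdivrMl; last by rewrite ltr0n bin_gt0 leq_addl.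
by rewrite muleC -/b [(@lebesgue_mx R m k) P * b]muleC -muleA.
Qed.

Lemma section_projection_le (R : realType) m k n
    (K : set ('M[R]_(m, k) * 'rV[R]_n)) (P : set 'M[R]_(m, k)) x0 :
  measurable K -> measurable P -> convex_prod K ->
  (forall x, P x -> exists z, K (x, z)) ->
  lebesgue_mx P * lebesgue_rV (xsection K x0) <=
  'C(k * m + n, n)%:R%:E * (@lebesgue_mx R m k \x @lebesgue_rV R n) K.
Proof.
case: n K => [|n] K mK mP cK PK; last exact: section_projection_leS.
by rewrite bin0 mul1e; exact: section_projection_le0.
Qed.

(** [section_projection_le] applies to the superlevel sets of [F], convex by
    quasi-concavity, and to those of [h], which lie in their projections as [h] is
    below the fibrewise supremum of [F]. *)
Lemma section_projection_fun_le (R : realType) (m k n : nat)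
    (F : 'M[R]_(m, k) * 'rV[R]_n -> R) (h : 'M[R]_(m, k) -> R)
    (x0 : 'M[R]_(m, k)) (M : R) :
  measurable_fun setT F -> (forall p, 0 <= F p <= M)%R ->
  (forall p q t, 0 <= t <= 1 ->
     Num.min (F p) (F q) <= F ((1 - t) *: p.1 + t *: q.1, (1 - t) *: p.2 + t *: q.2))%R ->
  measurable_fun setT h -> (forall x, 0 <= h x)%R ->
  (forall x u, u < h x -> exists z, u < F (x, z))%R ->
  \int[@lebesgue_mx R m k]_x (h x)%:E * \int[@lebesgue_rV R n]_z (F (x0, z))%:E <=
  ('C(k * m + n, n)%:R * M)%:E * \int[@lebesgue_mx R m k \x @lebesgue_rV R n]_p (F p)%:E.
Proof.
move=> mF FM qF mh h0 hF.
have F0 p : (0 <= F p)%R by case/andP: (FM p).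
have F1 p : (F p <= M)%R by case/andP: (FM p).
have h1 x : (h x <= M)%R.
  by rewrite leNgt; apply/negP => /hF[z]; rewrite ltNge F1.
have M0 : (0 <= M)%R by exact: le_trans (F0 (x0, 0%R)) (F1 _).
pose g z := F (x0, z).
have g0 z : (0 <= g z)%R by exact: F0.
have mg : measurable_fun setT g.
  exact: (measurableT_comp mF (pair1_measurable x0)).
pose C : R := 'C(k * m + n, n)%:R.
have C0 : (0 <= C)%R by exact: ler0n.
pose l p : R := Num.min (h p.1) (g p.2).
have l0 p : (0 <= l p)%R by rewrite le_min h0 g0.
have ml : measurable_fun setT l.
  apply: measurable_minr.
    exact: (measurableT_comp mh measurable_fst).
  exact: (measurableT_comp mg measurable_snd).
rewrite -product_integral//.
have ml' (u : R) (d : measure_display) (T : measurableType d) (f : T -> R) :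
    measurable_fun setT f -> measurable [set x | (u < f x)%R].
  move=> mf.
  rewrite -[X in measurable X]setTI.
  by apply: (measurable_fun_ltr (measurable_cst u) mf measurableT (Y := [set true])).
(* The superlevel set of l at u is the product of those of h and g, so this is
   the inequality for sets, integrated over the levels. *)
have lF : \int[@lebesgue_mx R m k \x @lebesgue_rV R n]_p (l p)%:E <=
    C%:E * \int[@lebesgue_mx R m k \x @lebesgue_rV R n]_p (F p)%:E.
  pose munu :=
    product_sigma_finite_measure (@lebesgue_mx R m k) (@lebesgue_rV R n).
  have L f := @layer_cake _ _ _ munu f.
  have S f := @measurable_superlevel _ _ _ munu f.
  rewrite L// L// -ge0_integralZl//; last first.
    exact: measurable_funS (S _ mF).
  apply: ge0_le_integral => //.
  - exact: measurable_funS (S _ ml).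
  - by apply: measurable_funeM; exact: measurable_funS (S _ mF).
  move=> u; rewrite /= in_itv/= andbT => u0.
  rewrite (_ : [set x | (u < l x)%R] = [set x | u < h x]%R `*` [set z | u < g z]%R); last first.
    by apply/seteqP; split => -[x z]; rewrite /l/= lt_min => /andP.
  rewrite product_measure1E; [|exact: ml'..].
  rewrite (_ : [set z | _] = xsection [set p | u < F p]%R x0); last first.
    by apply/seteqP; split => z; rewrite /xsection/= inE.
  apply: section_projection_le; [exact: ml'|exact: ml'| |by move=> x; exact: hF].
  move=> p q t t01 /= up uq; apply: lt_le_trans (qF p q t t01).
  by rewrite lt_min up uq.
apply: (@le_trans _ _ (M%:E * \int[@lebesgue_mx R m k \x @lebesgue_rV R n]_p (l p)%:E)); last first.
  by rewrite mulrC EFinM -muleA lee_wpmul2l.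
have ml2 : measurable_fun setT (fun p => (l p)%:E) by exact/measurable_EFinP.
rewrite -ge0_integralZl ?lee_fin//; last by move=> p _; rewrite lee_fin.
apply: ge0_le_integral => //.
- by move=> p _; rewrite lee_fin mulr_ge0// g0.
- apply/measurable_EFinP; apply: measurable_funM.
    exact: (measurableT_comp mh measurable_fst).
  exact: (measurableT_comp mg measurable_snd).
- exact: measurable_funeM.
(* The product of two numbers of [0, M] is at most M times the smaller one. *)
move=> p _; rewrite -EFinM lee_fin /l.
have [hg|gh] := leP (h p.1) (g p.2).
  by rewrite mulrC ler_wpM2r.
by rewrite ler_wpM2r.
Qed.

End section_projection.

(** * Log-concave functions *)

Section log_concave.
Local Open Scope ereal_scope.
Variables (R : realType) (n : nat).
Implicit Types f : 'rV[R]_n -> R.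
Local Notation nu := (@lebesgue_rV R n).

Lemma LC_measurable f : LC f -> measurable_fun setT f.
Proof. by case=> _ _ _ /measurable_int /measurable_EFinP. Qed.

Lemma interpolate_gt (a c e : R) : (0 < c < a -> 0 < e ->
  exists2 t, 0 < t < 1 & c < a `^ (1 - t) * e `^ t)%R.
Proof.
move=> /andP[c0 ca] e0; have a0 : (0 < a)%R by exact: lt_trans ca.
(* In terms of d = ln a - ln c and D = ln a - ln e the goal is t * D < d. *)
pose d := (ln a - ln c)%R; pose D := (ln a - ln e)%R.
have d0 : (0 < d)%R by rewrite subr_gt0 ltr_ln ?posrE.
have D0 : (0 <= `|D|)%R by [].
have q0 : (0 < `|D| + 2 * d)%R by lra.
pose t := (d / (`|D| + 2 * d))%R.
have tq : (t * (`|D| + 2 * d) = d)%R by rewrite divfK// gt_eqF.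
have t0 : (0 < t)%R by rewrite divr_gt0.
have t1 : (t < 1)%R by rewrite ltr_pdivrMr//; lra.
exists t; first by rewrite t0 t1.
have tD : (t * D < d)%R.
  have : (t * D <= t * `|D|)%R by rewrite ler_pM2l// ler_norm.
  have : (0 < t * d)%R by rewrite mulr_gt0.
  lra.
rewrite -ltr_ln ?posrE//; last by rewrite mulr_gt0// powR_gt0.
rewrite lnM ?posrE ?powR_gt0// !ln_powR.
by move: tD; rewrite /d /D; lra.
Qed.

(** If [f] were almost everywhere at most some positive [c < f x0], then by
    log-concavity a homothety centred at [x0] would map each superlevel set
    [{f > e}], [e > 0], into the null set [{f > c}]; so [f] would vanish almost
    everywhere. *)
Lemma LC_le_ess_sup f x0 : LC f ->
  (f x0)%:E <= ess_sup nu (EFin \o f).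
Proof.
move=> Lf; have mf := LC_measurable Lf.
case: Lf => f0 lcf _ _ nae.
rewrite leNgt; apply/negP => fx0; apply: nae.
have aeE := ess_sup_ge nu (EFin \o f).
have [fx0n|fx0p] := leP (f x0) 0%R.
  apply: filterS aeE => x /= fxE.
  have := le_lt_trans fxE fx0; rewrite lte_fin => /lt_le_trans/(_ fx0n).
  by rewrite ltNge f0.
have [c /andP[c0 cf] aec] : exists2 c, (0 < c < f x0)%R &
    {ae nu, forall x, (f x)%:E <= c%:E}.
  have half : (0 < f x0 / 2 < f x0)%R by lra.
  move: fx0 aeE; case: (ess_sup _ _) => [e||]; rewrite ?lte_fin// => fx0 aeE.
    exists (Num.max e (f x0 / 2))%R.
      by have [h1 h2] := andP half; rewrite lt_max gt_max h1 h2 fx0 orbT.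
    by apply: filterS aeE => x /= /le_trans; apply; rewrite lee_fin le_max lexx.
  by exists (f x0 / 2)%R => //; apply: filterS aeE.
have mfe e : measurable [set x | (e < f x)%R].
  rewrite -[X in measurable X]setTI.
  by apply: (measurable_fun_ltr (measurable_cst e) mf measurableT (Y := [set true])).
have aeP e : {ae nu, forall x, (f x)%:E <= e%:E} <-> nu [set x | (e < f x)%R] = 0.
  rewrite ae_le_measureP; last exact/measurable_EFinP.
  rewrite (_ : _ @^-1` _ = [set x | (e < f x)%R])//.
  by apply/seteqP; split => x /=; rewrite in_itv/= andbT lte_fin.
(* The homothety of centre x0 and small ratio t maps {f > e} into {f > c}. *)
have key e : (0 < e)%R -> {ae nu, forall x, (f x)%:E <= e%:E}.
  move=> e0; apply/aeP; move/aeP : aec => nuc.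
  have [t /andP[t0 t1] ct] := interpolate_gt (introT andP (conj c0 cf)) e0.
  have rr := rV_rescales ((1 - t) *: x0)%R (lt0r_neq0 t0).
  have /eqP := etrans (rescales_measure rr (mfe c)) nuc.
  rewrite mule_eq0 eqe expf_eq0 normr_eq0 (gt_eqF t0) andbF/= => /eqP nu0.
  apply/eqP; rewrite eq_le measure_ge0 andbT -nu0; apply: le_measure; rewrite ?inE//.
    by rewrite -[X in measurable X]setTI; case: rr => + _ _; apply.
  move=> x /= ex; apply: lt_le_trans ct _.
  apply: le_trans (lcf x0 x t _); last by rewrite !ltW.
  rewrite ler_wpM2l ?powR_ge0//.
  by apply: ge0_ler_powR; rewrite ?nnegrE ?f0 ?(ltW e0) ?(ltW t0) ?(ltW ex).
have : {ae nu, forall x, forall k : nat, (f x)%:E <= (k.+1%:R^-1)%:E}.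
  by apply: ae_foralln => k; apply: key; rewrite invr_gt0.
apply: filterS => x H; apply/le_anti; rewrite f0 andbT.
rewrite leNgt; apply/negP => fx.
have := H (Num.truncn (f x)^-1); rewrite lee_fin leNgt => /negP; apply.
rewrite invf_plt ?posrE//; exact: Num.Theory.truncnS_gt.
Qed.

Lemma LC_integral_gt0 f : LC f ->
  0 < \int[nu]_z (f z)%:E.
Proof.
move=> Lf; have mf := LC_measurable Lf; case: Lf => f0 _ _ _ nae.
rewrite lt_neqAle integral_ge0 ?andbT => [|z _]; last by rewrite lee_fin.
apply/eqP => /esym I0; apply: nae.
have /ae_eq_integral_abs : measurable_fun setT (EFin \o f) by exact/measurable_EFinP.
move=> /(_ nu measurableT)[+ _].
under eq_integral do rewrite /= ger0_norm//.
by move=> /(_ I0); apply: filterS => z /(_ Logic.I) [].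
Qed.

Lemma LC_ess_sup_gt0 f : LC f ->
  0 < ess_sup nu (EFin \o f).
Proof.
move=> Lf; have [x fx] : exists x, (0 < f x)%R.
  case: Lf => f0 _ _ _ nae; apply: contrapT => H; apply: nae.
  apply: aeW => x; apply/eqP; rewrite eq_le f0 andbT leNgt.
  by apply/negP => fx; apply: H; exists x.
by rewrite (lt_le_trans _ (LC_le_ess_sup x Lf)).
Qed.

Lemma min_le_powR (a b t : R) : (0 <= a)%R -> (0 <= b)%R -> (0 <= t <= 1)%R ->
  (Num.min a b <= a `^ (1 - t) * b `^ t)%R.
Proof.
move=> a0 b0 /andP[t0 t1].
pose c := Num.min a b.
have [c0|c0] := leP c 0%R; first by rewrite (le_trans c0)// mulr_ge0// powR_ge0.
have ca : (c <= a)%R by rewrite ge_min lexx.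
have cb : (c <= b)%R by rewrite ge_min lexx orbT.
have c0' := ltW c0.
rewrite -/c -[c in leLHS]powRr1// -[1%R in leLHS](subrK t) powRD; last first.
  by rewrite (gt_eqF c0) implybT.
by apply: ler_pM; rewrite ?powR_ge0//; apply: ge0_ler_powR; rewrite ?nnegrE ?subr_ge0.
Qed.

Lemma prod_powR (I : Type) (r : seq I) (g : I -> R) t : (forall i, 0 <= g i)%R ->
  ((\prod_(i <- r) g i) `^ t = \prod_(i <- r) g i `^ t)%R.
Proof.
move=> g0; elim: r => [|i r IH]; first by rewrite !big_nil powR1.
by rewrite !big_cons powRM ?IH// prodr_ge0.
Qed.

End log_concave.

(** * The two convolutions *)

Section convolution.
Local Open Scope ereal_scope.
Variables (R : realType) (m n : nat) (f : 'I_m.+1 -> 'rV[R]_n -> R).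
Local Notation mu := (@lebesgue_mx R m n).
Local Notation nu := (@lebesgue_rV R n).

Lemma conv_integrand_ge0 x z : (forall i w, 0 <= f i w)%R -> (0 <= conv_integrand f x z)%R.
Proof. by move=> f0; rewrite mulr_ge0// prodr_ge0. Qed.

Lemma measurable_conv_integrand : (forall i, measurable_fun setT (f i)) ->
  measurable_fun setT (fun p : 'M[R]_(m, n) * 'rV[R]_n => conv_integrand f p.1 p.2).
Proof.
move=> mf; apply: measurable_funM.
  exact: (measurableT_comp (mf _) measurable_snd).
apply: measurable_prod => i _; apply: (measurableT_comp (mf _)).
apply/measurable_fun_mxP => j l.
under eq_fun do rewrite !mxE.
apply: measurable_funB.
  exact: (measurableT_comp (measurable_coord j l) measurable_snd).
exact: (measurableT_comp (measurable_coord i l) measurable_fst).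
Qed.

Lemma integral_reflect (g : 'rV[R]_n -> R) z : measurable_fun setT g ->
  (forall w, 0 <= g w)%R ->
  \int[nu]_w (g (z - w)%R)%:E = \int[nu]_w (g w)%:E.
Proof.
move=> mg g0.
have n1 : (-1 != 0 :> R)%R by rewrite oppr_eq0 oner_eq0.
have [_ _ /(_ (EFin \o g))] := rV_rescales z n1.
rewrite normrN1 expr1n => <-; last 2 first.
- exact/measurable_EFinP.
- by move=> w; rewrite lee_fin.
by rewrite mul1e; apply: eq_integral => w _ /=; rewrite scaleN1r.
Qed.

(** For fixed [z] the variables [x_i] separate, and each [w |-> f i (z - w)] has the
    same integral as [f i]. *)
Lemma integral_conv_integrand : (forall i, measurable_fun setT (f i)) ->
  (forall i w, 0 <= f i w)%R ->
  \int[mu \x nu]_p (conv_integrand f p.1 p.2)%:E = \prod_(i < m.+1) \int[nu]_z (f i z)%:E.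
Proof.
move=> mf f0.
have mF := measurable_conv_integrand mf.
have mF' : measurable_fun setT (fun p : 'M[R]_(m, n) * 'rV[R]_n => (conv_integrand f p.1 p.2)%:E).
  exact/measurable_EFinP.
rewrite (fubini_tonelli2 _ mF'); last by move=> p; rewrite lee_fin conv_integrand_ge0.
rewrite big_ord_recl -ge0_integralZr//; last 3 first.
- exact/measurable_EFinP.
- by move=> z _; rewrite lee_fin.
- by apply: prode_ge0 => i _; apply: integral_ge0 => z _; rewrite lee_fin.
apply: eq_integral => z _; rewrite /fubini_G /=.
under eq_integral do rewrite /conv_integrand EFinM.
have mP : measurable_fun setT (fun x : 'M[R]_(m, n) =>
    (\prod_(i < m) f (lift ord0 i) (z - row i x))%:E).
  apply/measurable_EFinP; apply: measurable_prod => i _.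
  apply: (measurableT_comp (mf _)); apply/measurable_fun_mxP => j l.
  under eq_fun do rewrite !mxE.
  by apply: measurable_funB => //; exact: measurable_coord.
have P0 x : 0 <= (\prod_(i < m) f (lift ord0 i) (z - row i x))%:E.
  by rewrite lee_fin prodr_ge0.
rewrite ge0_integralZl ?lee_fin//; congr (_ * _).
rewrite /lebesgue_mx (ge0_integral_pushforward (@measurable_mx_of_tuple R m n))//.
rewrite preimage_setT.
under [RHS]eq_bigr do rewrite -(integral_reflect z)//.
rewrite -tuple_integral_prod//.
  apply: eq_integral => t _ /=; congr EFin; apply: eq_bigr => i _.
  by congr (f _ (_ - _)%R); apply/rowP => j; rewrite !mxE.
move=> i; apply: (measurableT_comp (mf _)); apply/measurable_fun_mxP => j l.
under eq_fun do rewrite !mxE.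
by apply: measurable_funB => //; exact: measurable_coord.
Qed.

(** A product of log-concave functions of affine maps is log-concave, hence
    quasi-concave. *)
Lemma conv_integrand_min (p q : 'M[R]_(m, n) * 'rV[R]_n) (t : R) :
  (forall i w, 0 <= f i w)%R -> (forall i, log_concave (f i)) -> (0 <= t <= 1)%R ->
  (Num.min (conv_integrand f p.1 p.2) (conv_integrand f q.1 q.2) <=
  conv_integrand f ((1 - t) *: p.1 + t *: q.1) ((1 - t) *: p.2 + t *: q.2))%R.
Proof.
move=> f0 lf t01.
apply: le_trans (min_le_powR (conv_integrand_ge0 _ _ f0) (conv_integrand_ge0 _ _ f0) t01) _.
rewrite /conv_integrand !powRM ?prodr_ge0//.
rewrite !prod_powR// mulrACA -big_split/=.
apply: ler_pM; rewrite ?mulr_ge0 ?powR_ge0 ?prodr_ge0//.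
- by move=> i _; rewrite mulr_ge0 ?powR_ge0.
- exact: lf.
apply: ler_prod => i _; rewrite mulr_ge0 ?powR_ge0//=.
apply: le_trans (lf _ _ _ _ t01) _.
rewrite le_eqVlt; apply/orP; left; apply/eqP; congr (f _ _).
by apply/rowP => j; rewrite !mxE; ring.
Qed.

Lemma star_conv_ge0 x : (forall i w, 0 <= f i w)%R -> 0 <= star_conv f x.
Proof.
move=> f0; apply: (@le_trans _ _ (conv_integrand f x 0%R)%:E).
  by rewrite lee_fin conv_integrand_ge0.
by apply: ereal_sup_ubound; exists 0%R.
Qed.

Lemma star_conv_oplus_le (M : 'I_m.+1 -> R) (x0 : 'M[R]_(m, n)) :
  (forall i, LC (f i)) -> (forall i z, f i z <= M i)%R ->
  \int[mu]_x star_conv f x * oplus_conv f x0 <=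
  ('C(n * m + n, n)%:R * \prod_i M i)%:E * \prod_i \int[nu]_z (f i z)%:E.
Proof.
move=> Lf fM.
have f0 i z : (0 <= f i z)%R by case: (Lf i).
have mf i : measurable_fun setT (f i) by exact: LC_measurable.
have M0 i : (0 <= M i)%R by exact: le_trans (f0 i 0%R) (fM _ _).
apply: integral_mul_le => [x|||h mh h0 hG].
- exact: star_conv_ge0.
- by apply: integral_ge0 => z _; rewrite lee_fin conv_integrand_ge0.
- apply: mule_ge0; first by rewrite lee_fin mulr_ge0// prodr_ge0.
  by apply: prode_ge0 => i _; apply: integral_ge0 => z _; rewrite lee_fin.
rewrite -integral_conv_integrand//.
apply: (section_projection_fun_le (F := fun p => conv_integrand f p.1 p.2)) => //.
- exact: measurable_conv_integrand.
- move=> p; rewrite conv_integrand_ge0//= big_ord_recl ler_pM ?prodr_ge0//.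
  by apply: ler_prod => i _; rewrite f0 fM.
- by move=> p q t t01; apply: conv_integrand_min => // i; case: (Lf i).
move=> x u uh; have : u%:E < star_conv f x by rewrite (lt_le_trans _ (hG x))// lte_fin.
by move=> /ereal_sup_gt[_ [z _ <-]]; rewrite lte_fin; exists z.
Qed.

End convolution.

(** * The inequality *)

Theorem theorem1p8 (R : realType) (n m : nat) (f : 'I_m.+1 -> 'rV[R]_n -> R)
    (hf : forall i, LC (f i)) :
  (ess_sup (@lebesgue_mx R m n) (oplus_conv f)
     * \int[@lebesgue_mx R m n]_x star_conv f x
   <= ('C(n * (m + 1), n)%:R : R)%:E
     * \prod_(i < m.+1) (ess_sup (@lebesgue_rV R n) (EFin \o f i)
                          * \int[@lebesgue_rV R n]_z (f i z)%:E))%E.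
Proof.
set nu := @lebesgue_rV R n.
have f0 i z : (0 <= f i z)%R by case: (hf i).
pose E i := ess_sup nu (EFin \o f i).
pose I i := (\int[nu]_z (f i z)%:E)%E.
have EI0 i : (0 < E i * I i)%E.
  by apply: mule_gt0; [exact: LC_ess_sup_gt0|exact: LC_integral_gt0].
(* If some f i is unbounded, the right-hand side is infinite, since all the other
   factors are positive. *)
have [[i0 Ei0]|Efin] := pselect (exists i, E i = +oo%E).
  have -> : (\prod_(i < m.+1) (E i * I i) = +oo)%E.
    rewrite (bigD1 i0)//= Ei0 gt0_mulye; last exact: LC_integral_gt0.
    rewrite gt0_mulye//.
    by elim/big_ind : _ => // x y; exact: mule_gt0.
  by rewrite gt0_muley ?leey// lte_fin ltr0n bin_gt0 leq_pmulr// addn1.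
have fE i : (E i = (fine (E i))%:E)%E.
  rewrite fineK// gt0_fin_numE ?LC_ess_sup_gt0// lt_neqAle leey andbT.
  by apply/eqP => Ei; apply: Efin; exists i.
have fM i z : (f i z <= fine (E i))%R by rewrite -lee_fin -fE; exact: LC_le_ess_sup.
rewrite big_split/= (eq_bigr _ (fun i _ => fE i)) prodEFin muleA -EFinM.
rewrite mulnDr muln1.
have G0 : (0 <= \int[@lebesgue_mx R m n]_x star_conv f x)%E.
  by apply: integral_ge0 => x _; exact: star_conv_ge0.
apply: (@le_trans _ _ (ereal_sup (range (oplus_conv f)) *
    \int[@lebesgue_mx R m n]_x star_conv f x)%E).
  apply: lee_wpmul2r => //; apply/ess_supP; apply: nearW => x.
  by apply: ereal_sup_ubound; exists x.
apply: mul_ereal_sup_le => //.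
  apply: mule_ge0; last first.
    by apply: prode_ge0 => i _; apply: integral_ge0 => z _; rewrite lee_fin.
  rewrite lee_fin mulr_ge0// prodr_ge0// => i _.
  exact: le_trans (f0 i 0) (fM i 0).
move=> _ [x _ <-]; rewrite muleC.
exact: star_conv_oplus_le.
Qed.
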